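(* Let $\Omega$, $F$, $K$, $e$ be as in the context, and write $F(A):=\bigcup_{x\in A}F(x)$ for $A\subseteq\mathbb{R}^n$. (i) Suppose that $F(\operatorname{wargmin}(\mathcal{SP}))$ is bounded. Then for every $\varepsilon>0$ there exists $p\in\mathbb{N}$ such that $\operatorname{wargmin}_x(\mathcal{VP}_p)\subseteq\operatorname{wargmin}(\mathcal{SP})\subseteq\varepsilon\text{-}\operatorname{wargmin}_x(\mathcal{VP}_p)$. (ii) Suppose that $F(\operatorname{argmin}^{II}(\mathcal{SP}))$ is bounded. Then for every $\varepsilon>0$ there exists $p\in\mathbb{N}$ such that $\operatorname{argmin}_x(\mathcal{VP}_p)\subseteq\operatorname{argmin}^{II}(\mathcal{SP})\subseteq\varepsilon\text{-}\operatorname{argmin}_x(\mathcal{VP}_p)$.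
   Context: $\mathbb{N}=\{1,2,\ldots\}$ and $[p]=\{1,\ldots,p\}$. Setting: $\Omega\subseteq\mathbb{R}^n$ is nonempty and closed; $F:\mathbb{R}^n\rightrightarrows\mathbb{R}^m$ is a set-valued mapping with $\Omega\subseteq \operatorname{dom}F:=\{x: F(x)\neq\emptyset\}$ and $F(x)$ compact for every $x\in\Omega$; $K\subseteq\mathbb{R}^m$ is a closed, convex, pointed ($K\cap(-K)=\{0\}$), solid ($\operatorname{int}K\ne\emptyset$) cone; $e\in\operatorname{int}K$ is fixed. Set optimization problem $(\mathcal{SP})$: minimize $F(x)$ over $x\in\Omega$ with respect to the lower set less relation. A point $\bar x\in\Omega$ is a weakly minimal solution of $(\mathcal{SP})$ if there is no $x\in\Omega$ with $F(\bar x)\subseteq F(x)+\operatorname{int}K$; it is a type-two minimal solution if there is no $x\in\Omega$ with $F(\bar x)\subseteq F(x)+K\setminus\{0\}$. The sets of these solutions are denoted $\operatorname{wargmin}(\mathcal{SP})$ and $\operatorname{argmin}^{II}(\mathcal{SP})$, respectively. Multiobjective problem $(\mathcal{VP}_p)$, $p\in\mathbb{N}$: minimize $(y^1,\ldots,y^p)\in\mathbb{R}^{mp}$ with respect to the cone $K^p=\prod_{i=1}^pK$ over all feasible $(x,y^1,\ldots,y^p)$, i.e. $x\in\Omega$ and $y^i\in F(x)$ for all $i\in[p]$. For $\varepsilon\ge0$, a feasible $(\bar x,\bar y^1,\ldots,\bar y^p)$ is an $\varepsilon$-weakly minimal solution if there is no feasible $(x,y^1,\ldots,y^p)$ with $\bar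 y^i-\varepsilon e-y^i\in\operatorname{int}K$ for all $i\in[p]$; it is an $\varepsilon$-minimal solution if there is no feasible $(x,y^1,\ldots,y^p)$ with $(\bar y^1-\varepsilon e-y^1,\ldots,\bar y^p-\varepsilon e-y^p)\in K^p\setminus\{0\}$. The sets $\varepsilon\text{-}\operatorname{wargmin}_x(\mathcal{VP}_p)$ and $\varepsilon\text{-}\operatorname{argmin}_x(\mathcal{VP}_p)$ are the projections onto the $x$-component in $\mathbb{R}^n$ of the sets of $\varepsilon$-weakly minimal and $\varepsilon$-minimal solutions of $(\mathcal{VP}_p)$, respectively; the prefix $\varepsilon$- is dropped when $\varepsilon=0$. *)

(* Defs.v *)
From HB Require Import structures.
From mathcomp Require Import all_boot all_order all_algebra.
From mathcomp Require Import all_classical all_reals all_analysis.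
Import Order.TTheory GRing.Theory Num.Theory.
Import numFieldNormedType.Exports.

Set Implicit Arguments.
Unset Strict Implicit.
Unset Printing Implicit Defensive.

Local Open Scope classical_set_scope.
Local Open Scope ring_scope.

Definition minkowski_sum (V : zmodType) (A B : set V) : set V :=
  [set a + b | a in A & b in B].

Definition is_cone (R : realType) (m : nat) (K : set 'rV[R]_m) : Prop :=
  forall (t : R) (y : 'rV[R]_m), 0 <= t -> K y -> K (t *: y).

Definition pointed (R : realType) (m : nat) (K : set 'rV[R]_m) : Prop :=
  K `&` [set - y | y in K] = [set 0].

Definition solid (R : realType) (m : nat) (K : set 'rV[R]_m) : Prop :=
  interior K !=set0.

(* A set-valued map R^n => R^m is a function into [set 'rV[R]_m]. *)
Definition dom (R : realType) (n m : nat) (F : 'rV[R]_n -> set 'rV[R]_m) :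
    set 'rV[R]_n :=
  [set x | F x !=set0].

Section SetOptimization.
Variables (R : realType) (n m : nat).
Variables (Omega : set 'rV[R]_n) (F : 'rV[R]_n -> set 'rV[R]_m).
Variable K : set 'rV[R]_m.

Definition wargmin_SP : set 'rV[R]_n :=
  [set xb | Omega xb /\
    ~ exists x, Omega x /\ F xb `<=` minkowski_sum (F x) (interior K)].

Definition argminII_SP : set 'rV[R]_n :=
  [set xb | Omega xb /\
    ~ exists x, Omega x /\ F xb `<=` minkowski_sum (F x) (K `\ 0)].

End SetOptimization.

Section MultiobjectiveProblem.
Variables (R : realType) (n m : nat).
Variables (Omega : set 'rV[R]_n) (F : 'rV[R]_n -> set 'rV[R]_m).
Variables (K : set 'rV[R]_m) (e : 'rV[R]_m) (p : nat).

(* (R^m)^p is represented by ['I_p -> 'rV[R]_m], with its pointwise additive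
   group structure. *)
Definition cone_power : set ('I_p -> 'rV[R]_m) :=
  [set v | forall i, K (v i)].

Definition feasible_VP : set ('rV[R]_n * ('I_p -> 'rV[R]_m)) :=
  [set z | Omega z.1 /\ forall i, F z.1 (z.2 i)].

Definition eps_weakly_minimal_VP (eps : R) :
    set ('rV[R]_n * ('I_p -> 'rV[R]_m)) :=
  [set zb | feasible_VP zb /\
    ~ exists z, feasible_VP z /\
        forall i, interior K (zb.2 i - eps *: e - z.2 i)].

Definition eps_minimal_VP (eps : R) :
    set ('rV[R]_n * ('I_p -> 'rV[R]_m)) :=
  [set zb | feasible_VP zb /\
    ~ exists z, feasible_VP z /\
        (cone_power `\ 0) (fun i => zb.2 i - eps *: e - z.2 i)].

Definition eps_wargmin_VP (eps : R) : set 'rV[R]_n :=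
  [set z.1 | z in eps_weakly_minimal_VP eps].

Definition eps_argmin_VP (eps : R) : set 'rV[R]_n :=
  [set z.1 | z in eps_minimal_VP eps].

(* The unprefixed notions are the case eps = 0, so they formally mention [e]. *)
Definition wargmin_VP : set 'rV[R]_n := eps_wargmin_VP 0.

Definition argmin_VP : set 'rV[R]_n := eps_argmin_VP 0.

End MultiobjectiveProblem.

(* Main.v *)
Require Import Defs.
From HB Require Import structures.
From mathcomp Require Import all_boot all_order all_algebra.
From mathcomp Require Import all_classical all_reals all_analysis.
From mathcomp Require Import lra.
Import Order.TTheory GRing.Theory Num.Theory.
Import numFieldNormedType.Exports.

Set Implicit Arguments.
Unset Strict Implicit.
Unset Printing Implicit Defensive.

Local Open Scope classical_set_scope.
Local Open Scope ring_scope.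

(** A solution of the vector problem with tolerance [eps] only has to survive on
    finitely many sample points. Partition the bounded image into [p] cells so
    fine that two points [y], [z] of one cell satisfy
    [eps e + y - z \in int K], and let the [i]-th sample of [F x] be taken in the
    [i]-th cell whenever [F x] meets it. If these samples, shifted by [- eps e],
    are dominated by points of [F x'], then adding the cell estimate shows that
    every point of [F x] is dominated by a point of [F x']. The other inclusion
    holds for every [p > 0]: a dominated set has all its samples dominated. *)

(** The cells are grid cubes of side [d]: a point is coded by the integer parts of its shifted
    coordinates in units of [d]. The norm is the maximum norm, so equal codes give distance below
    [d]. *)
Lemma bounded_finite_partition (R : realType) (m : nat) (B : set 'rV[R]_m)
    (d : R) : bounded_set B -> 0 < d ->
  exists p (c : 'rV[R]_m -> 'I_p), (0 < p)%N /\
    forall y z, B y -> B z -> c y = c z -> `|y - z| < d.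
Proof.
move=> bB d0; have [M M0 hM] := ex_strict_bound_gt0 bB.
pose t (y : 'rV[R]_m) j : R := (y 0 j + M) / d.
pose N := Num.truncn ((M + M) / d).
pose g (y : 'rV[R]_m) : {ffun 'I_m -> 'I_N.+1} :=
  [ffun j => inord (Num.truncn (t y j))].
have bnd y j : B y -> `|y 0 j| < M.
  move=> /hM /=; apply: le_lt_trans.
  by rewrite [`|y|]mx_normrE; exact: (le_bigmax _ _ (0, j)).
have t0 y j : B y -> 0 <= t y j.
  move=> /(bnd _ j); rewrite ltr_norml => /andP[h _].
  by rewrite divr_ge0 ?ltW// -(opprK M) subr_gt0.
have tN y j : B y -> (Num.truncn (t y j) < N.+1)%N.
  move=> By; rewrite ltnS /N; apply: le_truncn.
  move: (bnd _ j By); rewrite ltr_norml => /andP[_ h].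
  by rewrite ler_pM2r ?invr_gt0// lerD2r ltW.
exists #|{: {ffun 'I_m -> 'I_N.+1}}|, (fun y => enum_rank (g y)); split.
  by rewrite card_ffun !card_ord expn_gt0.
move=> y z By Bz /enum_rank_inj /ffunP gyz.
rewrite [`|_|]mx_normrE; apply: bigmax_lt => //= -[i j] _ /=.
rewrite (ord1 i) !mxE; move: (gyz j); rewrite !ffunE => /(congr1 val).
rewrite /= !inordK ?tN// => eqt.
have -> : y 0 j - z 0 j = d * (t y j - t z j).
  by rewrite -mulrBl mulrC divfK ?gt_eqF// opprD addrACA subrr addr0.
rewrite normrM gtr0_norm// gtr_pMr//.
have /andP[] := truncn_itv (t0 _ j By); have /andP[] := truncn_itv (t0 _ j Bz).
rewrite eqt -natr1 => h1 h2 h3 h4.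
by rewrite ltr_norml; apply/andP; split; lra.
Qed.

(** Cells that miss [A] get an arbitrary point of [A], so that all samples lie in [A] and form a
    feasible tuple. *)
Lemma cell_representatives (T : Type) (p : nat) (c : T -> 'I_p) (A : set T) :
  A !=set0 -> exists s : 'I_p -> T,
    (forall i, A (s i)) /\ forall y, A y -> c (s (c y)) = c y.
Proof.
move=> [a Aa].
have /choice[s hs] (i : 'I_p) : exists y, A y /\
    forall z, A z -> c z = i -> c y = i.
  have [[z [Az czi]]|noz] := pselect (exists z, A z /\ c z = i).
    by exists z.
  by exists a; split=> // z Az czi; exfalso; apply: noz; exists z.
by exists s; split=> [i|y Ay]; [case: (hs i)|apply: (hs (c y)).2 Ay _].
Qed.

Section ConvexCone.
Variables (R : realType) (m : nat) (K : set 'rV[R]_m).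
Hypotheses (K_convex : convex_set K) (K_cone : is_cone K).

(** The sum is twice the midpoint. *)
Lemma convex_coneD y z : K y -> K z -> K (y + z).
Proof.
move=> Ky Kz; have [h0 h1] : 0 <= 2^-1 :> R /\ 2^-1 <= 1 :> R by split; lra.
have := @K_convex y z (Itv01 h0 h1) (mem_set Ky) (mem_set Kz).
move=> /set_mem; rewrite /conv /= => /(K_cone (ler0n _ 2)).
rewrite scalerDr !scalerA /unstable.onem.
have -> : 2 * (1 - 2^-1) = 1 :> R by lra.
by rewrite divff ?pnatr_eq0// !scale1r.
Qed.

Lemma interior_coneD y z : interior K y -> K z -> interior K (y + z).
Proof.
move=> Ky Kz; have := nbhsB z Ky; rewrite addrC; apply: filterS => _ [w Kw <-].
by apply: convex_coneD.
Qed.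

Lemma interior_cone_scale (t : R) y :
  0 < t -> interior K y -> interior K (t *: y).
Proof.
move=> t0 Ky; have := nbhsZ (lt0r_neq0 t0) Ky; apply: filterS => _ [w Kw <-].
by apply: K_cone => //; exact: ltW.
Qed.

Lemma interior_cone_slack (t : R) e : 0 < t -> interior K e ->
  exists2 d : R, 0 < d & forall u, `|u| < d -> interior K (t *: e + u).
Proof.
move=> t0 /(interior_cone_scale t0) /nbhs_interior /nbhs_ballP[d /= d0 sub].
exists d => // u ud; apply: sub.
by rewrite -ball_normE /= opprD addNKr normrN.
Qed.

(** Every [y] can be shrunk into a ball around [0] inside [K], then scaled back. *)
Lemma interior0_cone : interior K 0 -> forall y, K y.
Proof.
move=> /nbhs_ballP[d /= d0 sub] y.
have y0 : 0 < `|y| + 1 by rewrite ltr_wpDl.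
have t0 : 0 < d / (`|y| + 1) by rewrite divr_gt0.
suff /(@K_cone (d / (`|y| + 1))^-1) : K ((d / (`|y| + 1)) *: y).
  by rewrite scalerA mulVf ?gt_eqF// scale1r; apply; rewrite invr_ge0 ltW.
apply: sub; rewrite -ball_normE /= sub0r normrN normrZ gtr0_norm//.
by rewrite mulrAC ltr_pdivrMr// ltr_pM2l// ltrDl.
Qed.

Hypothesis K_pointed : pointed K.

Lemma pointedP y : K y -> K (- y) -> y = 0.
Proof.
move=> Ky KNy; suff : (K `&` [set - z | z in K]) y by rewrite K_pointed.
by split=> //; exists (- y); rewrite ?opprK.
Qed.

(* [v] excludes [m = 0], where [0] is interior to the pointed cone [{0}]. *)
Lemma interior_pointed_coneD_neq0 y z (v : 'rV[R]_m) :
  v != 0 -> interior K y -> K z -> y + z != 0.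
Proof.
move=> v0 Ky Kz; apply/eqP => yz0.
have := interior_coneD Ky Kz; rewrite yz0 => /interior0_cone KT.
by move/eqP: v0; apply; exact: pointedP.
Qed.

End ConvexCone.

(** The difference [y - z (c y)] splits at the sample [s (c y)] into a term of [C] and a term of
    [D]. The sets stay abstract to serve both parts: [E] becomes [interior K] in one and [K] without
    [0] in the other. *)
Lemma cell_domination (R : realType) (m p : nat) (c : 'rV[R]_m -> 'I_p)
    (A B C D E : set 'rV[R]_m) (s z : 'I_p -> 'rV[R]_m) (a : 'rV[R]_m) :
  (forall y, A y -> C (a + (y - s (c y)))) ->
  (forall i, B (z i)) -> (forall i, D (s i - a - z i)) ->
  (forall u v, C u -> D v -> E (u + v)) ->
  A `<=` minkowski_sum B E.
Proof.
move=> AC Bz Dz CDE y Ay; exists (z (c y)) => //.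
exists (y - z (c y)); last by rewrite subrKC.
have -> : y - z (c y) = a + (y - s (c y)) + (s (c y) - a - z (c y)).
  by apply/rowP => j; rewrite !mxE; lra.
by apply: CDE => //; exact: AC.
Qed.

Lemma domination_selection (V : zmodType) (p : nat) (A B D : set V)
    (s : 'I_p -> V) :
  (forall i, A (s i)) -> A `<=` minkowski_sum B D ->
  exists z : 'I_p -> V, forall i, B (z i) /\ D (s i - z i).
Proof.
move=> As AB; suff /choice[z hz] (i : 'I_p) : exists y, B y /\ D (s i - y).
  by exists z.
by have [y By [k Dk <-]] := AB _ (As i); exists y; rewrite [y + k]addrC addrK.
Qed.

(** The partition is fixed before [A], so one [p] serves all solutions at once. The room around
    [eps *: e] inside [K] dictates the cell size. *)
Lemma uniform_samples (R : realType) (m : nat) (K : set 'rV[R]_m) (e : 'rV[R]_m)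
    (B : set 'rV[R]_m) (eps : R) :
  is_cone K -> interior K e -> bounded_set B -> 0 < eps ->
  exists p (c : 'rV[R]_m -> 'I_p), (0 < p)%N /\
    forall A, A !=set0 -> A `<=` B -> exists s : 'I_p -> 'rV[R]_m,
      (forall i, A (s i)) /\
      forall y, A y -> interior K (eps *: e + (y - s (c y))).
Proof.
move=> K_cone e_int bB eps0.
have [d d0 hd] := interior_cone_slack K_cone eps0 e_int.
have [p [c [p0 hc]]] := bounded_finite_partition bB d0.
exists p, c; split=> // A A0 AB.
have [s [As cs]] := cell_representatives c A0.
exists s; split=> // y Ay; apply/hd/hc; [exact: AB|exact/AB/As|by rewrite cs].
Qed.

Theorem corollary3p8 (R : realType) (n m : nat)
  (Omega : set 'rV[R]_n) (F : 'rV[R]_n -> set 'rV[R]_m)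
  (K : set 'rV[R]_m) (e : 'rV[R]_m)
  (Omega_neq0 : Omega !=set0) (Omega_closed : closed Omega)
  (Omega_dom : Omega `<=` dom F)
  (F_compact : forall x, Omega x -> compact (F x))
  (K_closed : closed K) (K_convex : convex_set K) (K_cone : is_cone K)
  (K_pointed : pointed K) (K_solid : solid K)
  (e_int : interior K e) :
  (bounded_set (\bigcup_(x in wargmin_SP Omega F K) F x) ->
   forall eps : R, 0 < eps ->
   exists p : nat, (0 < p)%N /\
     wargmin_VP Omega F K e p `<=` wargmin_SP Omega F K /\
     wargmin_SP Omega F K `<=` eps_wargmin_VP Omega F K e p eps)
  /\
  (bounded_set (\bigcup_(x in argminII_SP Omega F K) F x) ->
   forall eps : R, 0 < eps ->
   exists p : nat, (0 < p)%N /\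
     argmin_VP Omega F K e p `<=` argminII_SP Omega F K /\
     argminII_SP Omega F K `<=` eps_argmin_VP Omega F K e p eps).
Proof.
split=> bB eps eps0.
  have [p [c [p0 samples]]] := uniform_samples K_cone e_int bB eps0.
  exists p; split=> //; split.
    move=> _ [[x s] /= [[/= Ox Fs] nodom] <-]; split=> // -[x' [Ox' sub]].
    have [z hz] := domination_selection Fs sub.
    apply: nodom; exists (x', z); split=> [|i].
      by split=> //= i; case: (hz i).
    by rewrite /= scale0r subr0; case: (hz i).
  move=> x wx; have [Ox nodom] := wx.
  have [|s [Fs hs]] := samples (F x) (Omega_dom _ Ox).
    by move=> y Fy; exists x.
  exists (x, s) => //; split=> // -[[x' z] [[/= Ox' Fz] dom_z]].
  apply: nodom; exists x'; split=> //.
  apply: (cell_domination hs Fz dom_z) => u v Ku Kv.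
  by apply: interior_coneD => //; exact: interior_subset.
have [p [c [p0 samples]]] := uniform_samples K_cone e_int bB eps0.
exists p; split=> //; split.
  move=> _ [[x s] /= [[/= Ox Fs] nodom] <-]; split=> // -[x' [Ox' sub]].
  have [z hz] := domination_selection Fs sub.
  apply: nodom; exists (x', z); split=> [|/=].
    by split=> //= i; case: (hz i).
  (* One nonzero component makes the tuple of differences nonzero; index [0] exists because
     [0 < p]. *)
  split=> [i|/(congr1 (@^~ (Ordinal p0)))].
    by rewrite /= scale0r subr0; case: (hz i) => _ [].
  by rewrite /= scale0r subr0; case: (hz (Ordinal p0)) => _ [].
move=> x wx; have [Ox nodom] := wx.
have [|s [Fs hs]] := samples (F x) (Omega_dom _ Ox).
  by move=> y Fy; exists x.
exists (x, s) => //; split=> // -[[x' z] [[/= Ox' Fz] [dom_z dom_z0]]].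
(* A nonzero component is needed only as a witness that the space is nontrivial. *)
have [i vi0] : exists i, s i - eps *: e - z i != 0.
  apply: contrapT => all0; apply: dom_z0; apply/funext => i.
  by apply/eqP/negPn/negP => vi; apply: all0; exists i.
apply: nodom; exists x'; split=> //.
(* Here [D] is all of [K], since single components may vanish; the interior summand [u] keeps
   [u + v] nonzero. *)
apply: (cell_domination hs Fz dom_z) => u v Ku Kv.
split.
  by apply: interior_subset; exact: interior_coneD.
by apply/eqP; exact: (interior_pointed_coneD_neq0 K_convex K_cone K_pointed vi0).
Qed.
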